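(* Let $\ell\in\mathbb{N}\cup\{0\}$ and let $b_\ell(n)$ be the number of generalized non-Rascoe partitions of $n$ associated with $\ell$ (with $b_\ell(0)=1$). Then for $|q|<1$, \[ \sum_{n=0}^{\infty}b_\ell(n)q^n=(-q;q)_{\infty}\sum_{n=0}^{\infty}\frac{(-1)^nq^{n^2+\ell n}}{(-q;q)_n}. \]
   Context: A generalized non-Rascoe partition of $N$ associated with $\ell$ is a partition of $N$ into distinct parts such that (number of parts) $+\ell$ is not a part; the empty partition counts as one such partition of $0$. Notation: $(a;q)_0=1$, $(a;q)_n=\prod_{k=0}^{n-1}(1-aq^k)$, $(a;q)_\infty=\prod_{k\ge0}(1-aq^k)$. *)

(* Defs.v *)
From mathcomp Require Export all_boot all_order all_algebra.
From mathcomp Require Export complex.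
From mathcomp Require Export all_classical all_reals all_analysis.
Export numFieldNormedType.Exports.
Export Order.TTheory GRing.Theory Num.Theory.

Set Implicit Arguments.
Unset Strict Implicit.
Unset Printing Implicit Defensive.

Local Open Scope ring_scope.

(* A partition of n into distinct parts is encoded by the set A of its parts;
   every part is at most n, so that A : {set 'I_n.+1} loses no generality. *)
Definition distinct_partition (n : nat) (A : {set 'I_n.+1}) : bool :=
  [forall i in A, (0 < i)%N] && (\sum_(i in A) i == n)%N.

Definition non_rascoe (l n : nat) (A : {set 'I_n.+1}) : bool :=
  distinct_partition A && (#|A| + l \notin [seq val i | i in A])%N.

Definition num_non_rascoe (l n : nat) : nat :=
  #|[set A : {set 'I_n.+1} | non_rascoe l A]|.

Definition qpoch (K : numFieldType) (a q : K) (n : nat) : K :=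
  \prod_(0 <= k < n) (1 - a * q ^+ k).

Definition qpoch_inf (K : numFieldType) (a q : K) : K := limn (qpoch a q).

Definition gf_term (K : numFieldType) (l : nat) (q : K) (n : nat) : K :=
  (num_non_rascoe l n)%:R * q ^+ n.

Definition alt_term (K : numFieldType) (l : nat) (q : K) (n : nat) : K :=
  (-1) ^+ n * q ^+ (n ^ 2 + l * n) / qpoch (- q) q n.

(* Main.v *)
(** Write [P_n = (-q; q)_n] and [e_n = n^2 + l n].  Let [Y_n] be the signed sum
    [(-1)^n * sum_A q^(e_n + w_n(A))] over the finite sets [A] of positive parts
    that do not contain [#|A| + l + n], where [w_n(A)] is the sum of the parts of
    [A], each increased by [n]; thus [Y_0] is the generating function.  Drop the
    condition on [A] and subtract the sets that do contain [#|A| + l + n]: deleting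
    this part from such a set gives a set counted by [Y_(n+1)], because
    [e_(n+1) = e_n + l + 2 n + 1].  Hence [Y_n = Z_n + Y_(n+1)], where [Z_n] is the
    unrestricted sum.  Truncating everything at exponents at most [M] keeps this
    recurrence exact and makes [Y_(M+1)] vanish, so the partial sum of the
    generating function is the sum of the truncated [Z_n], [n <= M].  Finally
    [Z_n] differs from [(-1)^n q^(e_n) P_M / P_n] by terms with exponent above [M]
    only; with [|q| = s^2] their total is at most [s^M s^n (-s; s)_M], which
    disappears in the limit. *)
Require Import Defs.
From mathcomp Require Import zify ring.

Local Open Scope classical_set_scope.
Local Open Scope complex_scope.
Local Open Scope ring_scope.

(** * Shifted weights and the removal of a part *)

Definition shifted_weight {M : nat} (n : nat) (A : {set 'I_M.+1}) : nat :=
  (\sum_(i in A) (i + n))%N.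

Lemma shifted_weight0 (M : nat) (A : {set 'I_M.+1}) :
  shifted_weight 0 A = (\sum_(i in A) i)%N.
Proof. by apply: eq_bigr => i _; rewrite addn0. Qed.

Lemma shifted_weightS (M n : nat) (A : {set 'I_M.+1}) :
  shifted_weight n.+1 A = (shifted_weight n A + #|A|)%N.
Proof.
rewrite /shifted_weight -sum1_card -big_split /=.
by apply: eq_bigr => i _; rewrite addnS addn1.
Qed.

Lemma leq_shifted_weight (M n : nat) (A : {set 'I_M.+1}) (i : 'I_M.+1) :
  i \in A -> (i + n <= shifted_weight n A)%N.
Proof. by move=> iA; rewrite /shifted_weight (bigD1 i) //= leq_addr. Qed.

(** [inord k] collapses to [ord0] when [k] exceeds [M], whence the guard [k <= M]. *)
Lemma mem_vals (M k : nat) (A : {set 'I_M.+1}) :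
  (k \in [seq val i | i in A]) = (k <= M)%N && (inord k \in A).
Proof.
apply/fintype.imageP/andP => [[i iA ->]|[kM kA]].
  by rewrite inord_val -ltnS ltn_ord.
by exists (inord k); rewrite /= ?inordK.
Qed.

(* Deleting the part [#|A| + k] lowers the number of parts by one, so that this
   part was the new number of parts plus [k.+1]. *)
Lemma sum_remove_part (V : nmodType) (M e n k : nat) (F : nat -> V) :
  \sum_(A : {set 'I_M.+1} | [&& ord0 \notin A, e + shifted_weight n A <= M
        & #|A| + k \in [seq val i | i in A]]%N) F (e + shifted_weight n A)%N =
  \sum_(A : {set 'I_M.+1} |
      [&& ord0 \notin A, e + (k.+1 + n) + shifted_weight n.+1 A <= M
        & #|A| + k.+1 \notin [seq val i | i in A]]%N)
    F (e + (k.+1 + n) + shifted_weight n.+1 A)%N.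
Proof.
pose ins (A : {set 'I_M.+1}) := inord (#|A| + k.+1) |: A.
pose del (A : {set 'I_M.+1}) := A :\ inord (#|A| + k).
have wins (A : {set 'I_M.+1}) : inord (#|A| + k.+1) \notin A -> (#|A| + k.+1 <= M)%N ->
    (e + shifted_weight n (ins A) = e + (k.+1 + n) + shifted_weight n.+1 A)%N.
  move=> xA kM.
  rewrite /shifted_weight /ins big_setU1 //= inordK // -!/(shifted_weight _ _).
  rewrite shifted_weightS; set c := #|A| in kM *; lia.
rewrite (reindex_onto ins del); last first.
  move=> A /and3P[_ _]; rewrite mem_vals => /andP[kM kA].
  rewrite /ins /del; set x := inord _ in kA *.
  have -> : (#|A :\ x| + k.+1 = #|A| + k)%N by rewrite (cardsD1 x A) kA; lia.
  by rewrite finset.setD1K.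
have cond (A : {set 'I_M.+1}) : [&& ord0 \notin ins A, e + shifted_weight n (ins A) <= M
      & #|ins A| + k \in [seq val i | i in ins A]]%N && (del (ins A) == A) =
   [&& ord0 \notin A, e + (k.+1 + n) + shifted_weight n.+1 A <= M
        & #|A| + k.+1 \notin [seq val i | i in A]]%N.
  (* If this element is already in [A], both sides fail: on the left [del] would have to fix a set
     containing the element it deletes; on the right [#|A| + k.+1] must exceed [M], and then so does
     the weight. *)
  have [xA|xA] := boolP (inord (#|A| + k.+1) \in A).
    have insA : ins A = A by apply/finset.setUidPr; rewrite finset.sub1set.
    rewrite insA; apply/idP/idP.
      case/andP => /and3P[_ _]; rewrite !mem_vals => /andP[_ yA] /eqP delA.
      by move: yA; rewrite -{2}delA !inE eqxx.
    case/and3P => _ wM; rewrite mem_vals xA andbT -ltnNge => kM.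
    by exfalso; move: wM; rewrite shifted_weightS; set c := #|A| in kM *; lia.
  have cins : (#|ins A| + k = #|A| + k.+1)%N by rewrite finset.cardsU1 xA add1n addSnnS.
  have delK : del (ins A) = A by rewrite /del cins finset.setU1K.
  rewrite delK eqxx andbT cins !mem_vals (negPf xA) andbF /= andbT.
  rewrite finset.setU11 andbT.
  (* A part above [M] is ruled out on the left by the range of ['I_M.+1] and on the right by the
     weight, which is at least [#|A| + k.+1]. *)
  have [kM|kM] := leqP (#|A| + k.+1)%N M; last first.
    rewrite !andbF; apply/esym/negP => /andP[_].
    by rewrite shifted_weightS; set c := #|A| in kM *; lia.
  rewrite wins // andbT; congr andb.
  rewrite !inE negb_or andbC; case: (ord0 \notin A) => //=.
  apply/eqP => /(congr1 val) /=; rewrite inordK //; lia.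
apply: eq_big => [A|A]; first exact: cond.
rewrite cond => /and3P[_ wM]; rewrite mem_vals.
have kM : (#|A| + k.+1 <= M)%N.
  by move: wM; rewrite shifted_weightS; set c := #|A|; lia.
by rewrite kM /= => xA; rewrite wins.
Qed.

(** * The truncated recurrence and its iteration *)

Section FiniteIdentity.

Variables (K : numFieldType) (l : nat) (q : K) (M : nat).

(** The truncation of [Y_n] without its sign [(-1)^n], so that the recurrence subtracts the next
    term. *)
Definition restricted_sum (n : nat) : K :=
  \sum_(A : {set 'I_M.+1} |
      [&& ord0 \notin A, n ^ 2 + l * n + shifted_weight n A <= M
        & #|A| + (l + n) \notin [seq val i | i in A]]%N)
    q ^+ (n ^ 2 + l * n + shifted_weight n A)%N.

Definition unrestricted_sum (n : nat) : K :=
  \sum_(A : {set 'I_M.+1} |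
      [&& ord0 \notin A & n ^ 2 + l * n + shifted_weight n A <= M]%N)
    q ^+ (n ^ 2 + l * n + shifted_weight n A)%N.

Lemma restricted_sum_rec (n : nat) : restricted_sum n = unrestricted_sum n - restricted_sum n.+1.
Proof.
apply/eqP; rewrite eq_sym subr_eq; apply/eqP; rewrite /unrestricted_sum.
rewrite (bigID (fun A : {set 'I_M.+1} => #|A| + (l + n) \in [seq val i | i in A])%N).
rewrite /= addrC; congr +%R; first by apply: eq_bigl => A; rewrite -andbA.
under eq_bigl => A do rewrite -andbA.
rewrite (sum_remove_part _ M (n ^ 2 + l * n) n (l + n) (fun m => q ^+ m)).
have e : (n ^ 2 + l * n + ((l + n).+1 + n) = n.+1 ^ 2 + l * n.+1)%N by nia.
by rewrite e /restricted_sum [(l + n.+1)%N]addnS.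
Qed.

(** Every exponent is at least [n ^ 2 >= n], so no set meets the truncation. *)
Lemma restricted_sum_eq0 (n : nat) : (M < n)%N -> restricted_sum n = 0.
Proof.
move=> Mn; apply: big_pred0 => A; apply/negP => /and3P[_ + _].
have n2 : (n <= n ^ 2)%N by nia.
lia.
Qed.

Lemma restricted_sum0E : restricted_sum 0 = \sum_(0 <= n < M.+1) (-1) ^+ n * unrestricted_sum n.
Proof.
have step N : restricted_sum 0 = \sum_(0 <= n < N) (-1) ^+ n * unrestricted_sum n
    + (-1) ^+ N * restricted_sum N.
  elim: N => [|N ->]; first by rewrite big_nil add0r expr0 mul1r.
  rewrite big_nat_recr //= -addrA; congr +%R.
  by rewrite restricted_sum_rec exprS; ring.
by rewrite (step M.+1) restricted_sum_eq0 // mulr0 addr0.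
Qed.

End FiniteIdentity.

(** * Partial sums of the generating function *)

(** Summing over [n <= M] calls for one ambient type of parts. Enlarging it adds no partitions,
    since a part never exceeds the total [n]. *)
Lemma num_non_rascoe_widen (l n M : nat) : (n <= M)%N ->
  num_non_rascoe l n =
  #|[set A : {set 'I_M.+1} | [&& ord0 \notin A, shifted_weight 0 A == n
        & #|A| + l \notin [seq val i | i in A]]%N]%SET|.
Proof.
move=> nM; have nM1 : (n.+1 <= M.+1)%N by [].
pose w (A : {set 'I_n.+1}) := [set widen_ord nM1 i | i in A]%SET.
have winj : injective (widen_ord nM1) by move=> i j /(congr1 val) /= ij; apply: val_inj.
have Winj : injective w by apply: imset_inj.
rewrite /num_non_rascoe -(card_imset _ Winj); apply: eq_card => B.
have card_w A : #|w A| = #|A| by rewrite card_imset.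
have sum_w A : shifted_weight 0 (w A) = (\sum_(i in A) i)%N.
  by rewrite shifted_weight0 big_imset //= => i j _ _; apply: winj.
have vals_w A k : (k \in [seq val i | i in w A]) = (k \in [seq val i | i in A]).
  apply/fintype.imageP/fintype.imageP => [[_ /imsetP[i iA ->] ->]|[i iA ->]]; first by exists i.
  by exists (widen_ord nM1 i) => //; apply: imset_f.
have nz_w A : (ord0 \notin w A) = [forall i in A, 0 < i]%N.
  apply/idP/forall_inP => [n0 i iA|n0].
    rewrite lt0n; apply: contra n0 => /eqP i0; apply/imsetP; exists i => //.
    by apply: val_inj; rewrite /= i0.
  by apply/negP => /imsetP[i /n0 + /(congr1 val) /= i0]; rewrite -i0.
have crit A : non_rascoe l A = [&& ord0 \notin w A, shifted_weight 0 (w A) == n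
        & #|w A| + l \notin [seq val i | i in w A]]%N.
  by rewrite nz_w sum_w card_w vals_w /non_rascoe /distinct_partition -andbA.
apply/imsetP/idP => [[A + ->]|]; first by rewrite !inE crit.
rewrite inE => hB.
have wB : B = w [set i | widen_ord nM1 i \in B]%SET.
  apply/setP => j; apply/idP/imsetP => [jB|[i + ->]]; last by rewrite inE.
  have jn : (j < n.+1)%N.
    by case/and3P: hB => _ /eqP <- _; rewrite ltnS -[val j]addn0 leq_shifted_weight.
  exists (Ordinal jn); last exact: val_inj.
  by rewrite inE (_ : widen_ord _ _ = j) //; apply: val_inj.
by exists [set i | widen_ord nM1 i \in B]%SET; rewrite // inE crit -wB.
Qed.

Lemma series_gf_term (K : numFieldType) (l : nat) (q : K) (M : nat) :
  series (gf_term l q) M.+1 = restricted_sum K l q M 0.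
Proof.
rewrite /series /= big_mkord /restricted_sum.
(* Sets are grouped by weight; [inord] is faithful here because the truncation keeps the weight at
   most [M]. *)
rewrite (partition_big (fun A : {set 'I_M.+1} => inord (shifted_weight 0 A) : 'I_M.+1) predT) //=.
apply: eq_bigr => n _.
rewrite /gf_term (@num_non_rascoe_widen l n M) -1?ltnS //.
rewrite -sum1dep_card natr_sum mulr_suml.
have wn (A : {set 'I_M.+1}) : (shifted_weight 0 A <= M)%N && (inord (shifted_weight 0 A) == n) =
    (shifted_weight 0 A == n)%N.
  apply/andP/eqP => [[wM /eqP <-]|->]; first by rewrite inordK.
  by rewrite -ltnS ltn_ord inord_val.
apply: eq_big => [A|A /and3P[_ /eqP wA _]]; last by rewrite mul1r muln0 add0n wA.
rewrite muln0 !add0n addn0 -wn -!andbA.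
by do 2 congr andb; rewrite andbC.
Qed.

(** * Product formulas and the truncation error *)

(** For these [i], the exponents [i + n] run through [n + 1, ..., M]: the factors of [P_M] that are
    missing from [P_n]. *)
Definition part_range (n M : nat) : pred 'I_M.+1 :=
  [pred i : 'I_M.+1 | (0 < i) && (i + n <= M)]%N.

Lemma sum_subsets_prod (K : numFieldType) (q : K) (n M : nat) (Q : pred 'I_M.+1) :
  \sum_(A : {set 'I_M.+1} | [forall i in A, Q i]) q ^+ shifted_weight n A =
  \prod_(i : 'I_M.+1 | Q i) (1 + q ^+ (i + n)).
Proof.
(* Indices outside [Q] get the factor [0 + 1], so expanding over all sets kills exactly those that
   leave [Q]. *)
rewrite [RHS]big_mkcond /=.
under [RHS]eq_bigr => i _.
  rewrite (_ : (if _ then _ else _) = (if Q i then q ^+ (i + n) else 0) + 1).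
    over.
  by case: ifP; rewrite ?add0r // addrC.
rewrite bigA_distr [LHS]big_mkcond /=; apply: eq_bigr => A _.
case: ifPn => [/forall_inP AQ|/forall_inPn[i iA nQi]].
  rewrite /shifted_weight expr_sum big_mkcond /=; apply: eq_bigr => i _.
  by case: ifP => // iA; rewrite AQ.
by rewrite (bigD1 i) //= iA (negPf nQi) mul0r.
Qed.

Lemma qpoch_split (K : numFieldType) (q : K) (n M : nat) : (n <= M)%N ->
  qpoch (- q) q M = qpoch (- q) q n *
    \prod_(i : 'I_M.+1 | part_range n M i) (1 + q ^+ (i + n)).
Proof.
move=> nM; rewrite /qpoch (@big_cat_nat _ _ _ n) //=; congr *%R.
rewrite -(big_mkord (fun i => (0 < i) && (i + n <= M))%N (fun i => 1 + q ^+ (i + n))).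
(* Splitting off the excluded index 0 aligns [i + n] with the exponent [k + 1] of the factor of
   index [k] in [qpoch]. *)
rewrite [RHS]big_mkcond big_nat_recl //= mul1r -big_mkcond /=.
rewrite -{1}[n]add0n big_addn (big_nat_widen _ _ M) ?leq_subr //=.
apply: eq_big => [i|i _]; first by lia.
by rewrite mulNr opprK -exprS addSn.
Qed.

(* The factorization [|q| = s ^+ 2] lets half of each exponent above [M] pay for
   the decay in [M] and the other half for the sum over all sets of parts. *)
Section TruncationError.

Variables (K : numFieldType) (l : nat) (q s : K).
Hypotheses (s_ge0 : 0 <= s) (s_le1 : s <= 1) (qE : `|q| = s ^+ 2).

Lemma qpoch_ge1 (n : nat) : 1 <= qpoch (- s) s n.
Proof.
rewrite /qpoch; elim/big_ind: _ => // [x y x1 y1|i _].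
  by rewrite -[1]mulr1 ler_pM.
by rewrite mulNr opprK -exprS lerDl exprn_ge0.
Qed.

(** A weight at most [M] forces all parts into [part_range], so expanding the product leaves only
    sets of exponent above [M] in the difference. *)
Lemma unrestricted_sum_error (n M : nat) : (n <= M)%N ->
  `| q ^+ (n ^ 2 + l * n) *
       \prod_(i : 'I_M.+1 | part_range n M i) (1 + q ^+ (i + n))
     - unrestricted_sum K l q M n | <= s ^+ M * s ^+ n * qpoch (- s) s M.
Proof.
move=> nM; set e := (n ^ 2 + l * n)%N.
rewrite -sum_subsets_prod mulr_sumr.
rewrite (bigID (fun A : {set 'I_M.+1} => e + shifted_weight n A <= M)%N) /=.
have -> : unrestricted_sum K l q M n = \sum_(A : {set 'I_M.+1} |
    [forall i in A, part_range n M i] && (e + shifted_weight n A <= M)%N)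
    q ^+ e * q ^+ shifted_weight n A.
  apply: eq_big => [A|A _]; last by rewrite exprD.
  have [wM|] := leqP (e + shifted_weight n A) M; last by rewrite !andbF.
  rewrite !andbT; apply/idP/forall_inP => [A0 i iA|AQ].
    rewrite /part_range inE lt0n; apply/andP; split.
      by apply: contra A0 => /eqP i0; rewrite (_ : ord0 = i) //; apply: val_inj.
    by have := leq_shifted_weight M n A i iA; lia.
  by apply/negP => /AQ.
rewrite addrAC subrr add0r.
apply: (le_trans (ler_norm_sum _ _ _)).
have sM (A : {set 'I_M.+1}) : ~~ (e + shifted_weight n A <= M)%N ->
    `|q ^+ e * q ^+ shifted_weight n A| <= s ^+ M * s ^+ n * s ^+ shifted_weight n A.
  (* With [w] the shifted weight, [2 (e + w) >= M + n + w], because [e + w > M] and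
     [e >= n ^ 2 >= n]. *)
  move=> wM; rewrite -exprD normrX qE -exprM -!exprD ler_wiXn2l //.
  have n2 : (n <= n ^ 2)%N by nia.
  move: wM; rewrite /e; lia.
apply: (@le_trans _ _ (\sum_(A : {set 'I_M.+1} | [forall i in A, part_range n M i])
    s ^+ M * s ^+ n * s ^+ shifted_weight n A)).
  rewrite [leRHS](bigID (fun A : {set 'I_M.+1} => e + shifted_weight n A <= M)%N) /=.
  apply: ler_wpDl; first by apply: sumr_ge0 => A _; rewrite !mulr_ge0 ?exprn_ge0.
  by apply: ler_sum => A /andP[_]; apply: sM.
rewrite -mulr_sumr sum_subsets_prod ler_wpM2l ?mulr_ge0 ?exprn_ge0 //.
(* The product over [part_range] is [P_M / P_n] at [s], and [P_n >= 1] there. *)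
rewrite (qpoch_split _ _ n) // ler_peMl ?qpoch_ge1 //.
by apply: prodr_ge0 => i _; rewrite addr_ge0 ?exprn_ge0.
Qed.

Lemma gf_alt_error (M : nat) : (forall n, qpoch (- q) q n != 0) ->
  `| qpoch (- q) q M * series (alt_term l q) M.+1 - series (gf_term l q) M.+1 |
    <= s ^+ M * qpoch (- s) s M * \sum_(0 <= n < M.+1) s ^+ n.
Proof.
move=> P0; rewrite series_gf_term restricted_sum0E /series /= !mulr_sumr -sumrB.
apply: (le_trans (ler_norm_sum _ _ _)); apply: ler_sum_nat => n /= nM.
have -> : qpoch (- q) q M * alt_term l q n - (-1) ^+ n * unrestricted_sum K l q M n =
  (-1) ^+ n * (q ^+ (n ^ 2 + l * n) *
     \prod_(i : 'I_M.+1 | part_range n M i) (1 + q ^+ (i + n)) - unrestricted_sum K l q M n).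
  rewrite (qpoch_split _ _ n) -1?ltnS // /alt_term.
  by field; exact: P0.
rewrite normrM normrX normrN1 expr1n mul1r mulrAC.
exact: unrestricted_sum_error.
Qed.

End TruncationError.

(** * Real estimates and convergence of complex sequences *)

Lemma prod1D_le_expR (R : realType) (a : nat -> R) (c : R) (n : nat) :
  (forall k, 0 <= a k) -> \sum_(0 <= k < n) a k <= c ->
  \prod_(0 <= k < n) (1 + a k) <= expR c.
Proof.
move=> a0 ac; apply: (@le_trans _ _ (expR (\sum_(0 <= k < n) a k))).
  rewrite expR_sum; apply: ler_prod => k _.
  by rewrite expR_ge1Dx addr_ge0.
by rewrite ler_expR.
Qed.

Lemma sum_expr_le (R : realType) (x : R) (n : nat) : 0 <= x < 1 ->
  \sum_(0 <= k < n) x ^+ k <= (1 - x)^-1.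
Proof.
case/andP=> x0 x1; have d0 : 0 < 1 - x by rewrite subr_gt0.
rewrite -[leRHS]mul1r ler_pdivlMr // mulrC big_mkord -opprB mulNr -subrX1 opprB.
by rewrite lerBlDr lerDl exprn_ge0.
Qed.

(* The topology on [R[i]] is only found through its [numFieldType] structure. *)
Local Notation complexField R := (R[i] : numFieldType) (only parsing).

Lemma norm_real_complex (R : realType) (x : R) : `|x%:C| = `|x|%:C.
Proof. by rewrite normc_def /= expr0n addr0 sqrtr_sqr. Qed.

Lemma cvg_real_complex (R : realType) (u : R ^nat) (a : R) :
  u @ \oo --> a -> (fun n => (u n)%:C : complexField R) @ \oo --> (a%:C : complexField R).
Proof.
move=> /cvgrPdist_lt ua; apply/cvgrPdist_lt => e e0.
have eE : e = (complex.Re e)%:C by rewrite RRe_real // gtr0_real.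
rewrite eE ltcR in e0; near=> n.
rewrite -rmorphB norm_real_complex eE ltcR.
near: n; exact: ua.
Unshelve. all: by end_near.
Qed.

Lemma norm_Re_le (R : realType) (z : R[i]) : `|complex.Re z|%:C <= `|z|.
Proof.
by rewrite normc_def lecR -sqrtr_sqr ler_wsqrtr // lerDl sqr_ge0.
Qed.

Lemma norm_Im_le (R : realType) (z : R[i]) : `|complex.Im z|%:C <= `|z|.
Proof.
by rewrite normc_def lecR -sqrtr_sqr ler_wsqrtr // lerDr sqr_ge0.
Qed.

(** The real and imaginary parts converge absolutely by comparison with a real geometric series, and
    are then recombined. *)
Lemma cvg_series_geometric_le (R : realType) (u : (complexField R) ^nat) (C s : R) :
  0 <= s < 1 -> (forall n, `|u n| <= (C * s ^+ n)%:C) -> cvgn (series u).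
Proof.
case/andP=> s0 s1 us.
have cv (f : R[i] -> R) : (forall z, `|f z|%:C <= `|z|) ->
    cvgn (series (f \o u)).
  move=> fz; apply: normed_cvg.
  have fu n : `|f (u n)| <= C * s ^+ n by rewrite -lecR (le_trans (fz _)).
  apply: (@series_le_cvg _ _ (geometric C s)) => //= [n|].
    exact: le_trans (fu n).
  by apply: is_cvg_geometric_series; rewrite ger0_norm.
have -> : series u = (fun n => (series (@complex.Re R \o u) n)%:C +
    'i%C * (series (@complex.Im R \o u) n)%:C).
  apply/funext => n; rewrite /series /= !rmorph_sum mulr_sumr -big_split /=.
  by apply: eq_bigr => k _; rewrite -complexE.
have cR := @cvg_real_complex R _ _ (cv _ (@norm_Re_le R)).
have cI := @cvg_real_complex R _ _ (cv _ (@norm_Im_le R)).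
exact: (cvgP _ (cvgD cR (cvgMl_tmp (a := 'i%C : complexField R) cI))).
Qed.

Lemma cvg0_geometric_le (R : realType) (u : (complexField R) ^nat) (C s : R) :
  0 <= s < 1 -> (forall n, `|u n| <= (C * s ^+ n)%:C) -> u @ \oo --> (0 : complexField R).
Proof.
move=> hs us; apply: cvg_series_cvg_0; exact: cvg_series_geometric_le us.
Qed.

(** * Uniform bounds on the q-Pochhammer symbols and convergence of both factors *)

Section Bounds.

Variables (R : realType) (s : R).
Hypothesis s01 : 0 <= s < 1.

Let s0 : 0 <= s. Proof. by case/andP: s01. Qed.
Let s1 : s < 1. Proof. by case/andP: s01. Qed.
Let d0 : 0 < 1 - s. Proof. by rewrite subr_gt0. Qed.

Lemma sum_exprS_le (c : R) (n : nat) : 0 <= c ->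
  \sum_(0 <= k < n) c * s ^+ k.+1 <= c / (1 - s).
Proof.
move=> c0; rewrite -mulr_sumr ler_wpM2l //.
apply: le_trans (sum_expr_le R s n s01); apply: ler_sum => k _.
by rewrite exprS ler_piMl ?exprn_ge0 // ltW.
Qed.

Lemma qpoch_le_expR (n : nat) : qpoch (- s) s n <= expR (1 - s)^-1.
Proof.
have -> : qpoch (- s) s n = \prod_(0 <= k < n) (1 + 1 * s ^+ k.+1).
  by apply: eq_bigr => k _; rewrite mulNr opprK -exprS mul1r.
apply: prod1D_le_expR => [k|]; first by rewrite mul1r exprn_ge0.
by rewrite -[(1 - s)^-1]mul1r sum_exprS_le.
Qed.

Variable q : R[i].
Hypothesis q_le : `|q| <= s%:C.

Lemma norm_exprn_le (k : nat) : `|q ^+ k| <= (s ^+ k)%:C.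
Proof.
rewrite normrX rmorphXn lerXn2r // nnegrE.
by rewrite ler0c.
Qed.

Lemma norm_qpoch_le (n : nat) : `|qpoch (- q) q n| <= (expR (1 - s)^-1)%:C.
Proof.
apply: (@le_trans _ _ (qpoch (- s) s n)%:C); last by rewrite lecR qpoch_le_expR.
rewrite /qpoch normr_prod rmorph_prod /=; apply: ler_prod => k _.
rewrite normr_ge0 /= !mulNr !opprK -!exprS rmorphD rmorph1.
by apply: (le_trans (ler_normD _ _)); rewrite normr1 lerD2l norm_exprn_le.
Qed.

(** Reverse triangle inequality; it keeps the factors of [P_n] away from 0. *)
Lemma norm_1Dexprn_ge (k : nat) : (1 - s ^+ k)%:C <= `|1 + q ^+ k|.
Proof.
rewrite rmorphB rmorph1 lerBlDr.
apply: le_trans (lerD (lexx _) (norm_exprn_le k)).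
by have := ler_normB (1 + q ^+ k) (q ^+ k); rewrite addrK normr1.
Qed.

Lemma qpoch_neq0 (n : nat) : qpoch (- q) q n != 0.
Proof.
rewrite /qpoch prodf_seq_neq0; apply/allP => k _ /=.
rewrite mulNr opprK -exprS -normr_gt0.
apply: lt_le_trans (norm_1Dexprn_ge k.+1).
by rewrite ltcR subr_gt0 exprn_ilt1.
Qed.

(** For [y = s ^+ k.+1 <= s], [1 / (1 - y) = 1 + y / (1 - y) <= 1 + y / (1 - s)], which reduces the
    inverse to a product bounded by [prod1D_le_expR]. *)
Lemma norm_qpoch_inv_le (n : nat) :
  `|(qpoch (- q) q n)^-1| <= (expR ((1 - s)^-1 / (1 - s)))%:C.
Proof.
pose B := \prod_(0 <= k < n) (1 + (1 - s)^-1 * s ^+ k.+1).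
apply: (@le_trans _ _ B%:C); last first.
  rewrite lecR; apply: prod1D_le_expR => [k|]; last first.
    by rewrite sum_exprS_le // invr_ge0 ltW.
  by rewrite mulr_ge0 ?exprn_ge0 // invr_ge0 ltW.
rewrite /qpoch -prodfV normr_prod rmorph_prod /=; apply: ler_prod => k _.
rewrite normr_ge0 /= !mulNr !opprK -!exprS normfV.
have y1 : s ^+ k.+1 <= s by rewrite exprS ler_piMr // exprn_ile1 // ltW.
have y0 : 0 <= s ^+ k.+1 by rewrite exprn_ge0.
have z0 : 0 < 1 - s ^+ k.+1 by rewrite subr_gt0 (le_lt_trans y1).
apply: (@le_trans _ _ ((1 - s ^+ k.+1)^-1)%:C).
  have w0 : 0 < (1 - s ^+ k.+1)%:C by rewrite ltcR.
  have v0 := lt_le_trans w0 (norm_1Dexprn_ge k.+1).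
  by rewrite fmorphV lef_pV2 ?posrE // norm_1Dexprn_ge.
rewrite lecR.
have -> : (1 - s ^+ k.+1)^-1 = 1 + (1 - s ^+ k.+1)^-1 * s ^+ k.+1.
  by field; rewrite gt_eqF.
by rewrite lerD2l ler_wpM2r // lef_pV2 ?posrE // lerD2l lerN2.
Qed.

(** The increments [P_(n+1) - P_n = P_n q^(n+1)] decay geometrically because [P_n] is bounded. *)
Lemma cvg_qpoch : cvgn (qpoch (- q) q : (complexField R) ^nat).
Proof.
have ct : cvgn (series (telescope (qpoch (- q) q : (complexField R) ^nat))).
  apply: (cvg_series_geometric_le R _ (expR (1 - s)^-1) s s01) => n.
  rewrite /telescope /= {1}/qpoch big_nat_recr //= -/(qpoch _ _ _).
  rewrite mulNr opprK -exprS mulrDr mulr1 addrAC subrr add0r.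
  rewrite normrM rmorphM; apply: ler_pM => //; first exact: norm_qpoch_le.
  apply: le_trans (norm_exprn_le n.+1) _; rewrite lecR exprS.
  by rewrite ler_piMl ?exprn_ge0 // ltW.
have -> : (qpoch (- q) q : (complexField R) ^nat) =
    (fun n => qpoch (- q) q 0 + series (telescope (qpoch (- q) q)) n).
  by apply/funext => n; rewrite -eq_sum_telescope.
exact: (cvgP _ (cvgD (cvg_cst _) ct)).
Qed.

Lemma cvg_series_alt_term (l : nat) : cvgn (series (alt_term l q : (complexField R) ^nat)).
Proof.
apply: (cvg_series_geometric_le R _ (expR ((1 - s)^-1 / (1 - s))) s s01) => n.
rewrite /alt_term normrM normrM normrX normrN1 expr1n mul1r mulrC rmorphM.
apply: ler_pM => //; first exact: norm_qpoch_inv_le.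
apply: le_trans (norm_exprn_le _) _; rewrite lecR ler_wiXn2l //; first exact: ltW.
by apply: leq_trans (leq_addr _ _); nia.
Qed.

End Bounds.

(** * Passage to the limit *)

Theorem theorem4p6 (R : realType) (l : nat) (q : R[i]) (hq : `|q| < 1) :
  [/\ cvgn (series (gf_term l q)),
      cvgn (qpoch (- q) q),
      cvgn (series (alt_term l q)) &
      limn (series (gf_term l q)) =
        qpoch_inf (- q) q * limn (series (alt_term l q))].
Proof.
(* One [s] serves both purposes: [|q| = s ^+ 2] for the truncation error, and [|q| <= s < 1] for the
   convergence bounds. *)
pose s : R := Num.sqrt (complex.Re `|q|).
have nqE : `|q| = (complex.Re `|q|)%:C by rewrite RRe_real // normr_real.
have r0 : 0 <= complex.Re `|q| by rewrite -ler0c -nqE.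
have r1 : complex.Re `|q| < 1 by rewrite -ltcR -nqE.
have qE : `|q| = s%:C ^+ 2 by rewrite -rmorphXn sqr_sqrtr.
have s01 : 0 <= s < 1.
  by rewrite sqrtr_ge0 -[ltRHS]sqrtr1 ltr_sqrt.
have q_le : `|q| <= s%:C.
  rewrite qE -rmorphXn lecR.
  by case/andP: s01 => s0 s1; rewrite expr2 ler_piMr // ltW.
have cP := cvg_qpoch R s s01 q q_le.
have cA := cvg_series_alt_term R s s01 q q_le l.
(* The indices [n] and [n.+1] are those paired in [gf_alt_error]. *)
have cPA : (fun n => qpoch (- q) q n * series (alt_term l q) n.+1) @ \oo -->
    qpoch_inf (- q) q * limn (series (alt_term l q)).
  by apply: cvgM; [exact: cP | rewrite cvg_shiftS; exact: cA].
suff lim_gf : series (gf_term l q) @ \oo -->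
    qpoch_inf (- q) q * limn (series (alt_term l q)).
  split; [exact: cvgP lim_gf | exact: cP | exact: cA |].
  by apply: cvg_lim; [exact: norm_hausdorff | exact: lim_gf].
pose gf (n : nat) : complexField R := series (gf_term l q) n.+1.
pose alt (n : nat) : complexField R := qpoch (- q) q n * series (alt_term l q) n.+1.
suff err0 : (gf - alt) @ \oo --> (0 : complexField R).
  rewrite -cvg_shiftS.
  exact: (cvg_sub0 err0 cPA).
(* The constant bounds [qpoch (- s) s n] times the geometric sum in [gf_alt_error], uniformly in
   [n]; the factor [s ^+ n] remains. *)
apply: (cvg0_geometric_le R _ (expR (1 - s)^-1 * (1 - s)^-1) s s01) => n.
case/andP: (s01) => s0 s1.
have sC0 : 0 <= s%:C by rewrite ler0c.
have sC1 : s%:C <= 1 by rewrite (lecR s 1) ltW.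
rewrite -normrN opprB /gf /alt.
apply: (le_trans (gf_alt_error _ l q s%:C sC0 sC1 qE n (qpoch_neq0 R s s01 q q_le))).
have -> : qpoch (- s%:C) s%:C n = (qpoch (- s) s n)%:C.
  rewrite /qpoch rmorph_prod; apply: eq_bigr => k _.
  by rewrite rmorphB rmorph1 rmorphM rmorphN rmorphXn.
have -> : \sum_(0 <= k < n.+1) s%:C ^+ k = (\sum_(0 <= k < n.+1) s ^+ k)%:C.
  by rewrite rmorph_sum; apply: eq_bigr => k _; rewrite rmorphXn.
rewrite -rmorphXn -!rmorphM lecR -mulrA [leRHS]mulrC ler_wpM2l ?exprn_ge0 //.
apply: ler_pM; rewrite ?qpoch_le_expR ?sum_expr_le //.
  exact: le_trans ler01 (qpoch_ge1 _ s s0 n).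
by apply: sumr_ge0 => k _; rewrite exprn_ge0.
Qed.
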